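(* Let $R\subseteq S$ be an extension of rings with the same set of local units $\mathsf{E}$. Then there is an exact sequence of groups $$1\longrightarrow \mathrm{Ker}\big(\widehat{(-)}\big)\longrightarrow \mathbf{Aut}_{S-R}(S)\xrightarrow{\ \widehat{(-)}\ }\mathbf{Aut}_{R\text{-rings}}(S)\xrightarrow{\ [S_{-}]\ }\mathbf{Pic}(S),$$ where $$\mathrm{Ker}\big(\widehat{(-)}\big)=\{\lambda\in\mathbf{Aut}_{S-R}(S)\mid \lambda(e)\in U(\mathscr{Z}(eSe))\ \text{for every idempotent } e\in\mathsf{E}\}.$$ In particular, $\mathrm{Ker}\big(\widehat{(-)}\big)=\mathbf{Aut}_{S-S}(S)$, the group of all $S$-bilinear automorphisms of $S$.
   Context: Rings are associative, not necessarily unital. A set $\mathsf{E}$ of idempotents of a ring $R$ is a set of local units if for every finite subset $\{r_1,\dots,r_n\}\subseteq R$ there is $e\in\mathsf{E}$ with $er_i=r_ie=r_i$ for all $i$. An extension of rings with the same set of local units $\mathsf{E}$ is a ring $S$ with a subring $R\subseteq S$ such that $\mathsf{E}\subseteq R$ is a set of local units for both $R$ and $S$. For $s\in S$, $Unit\{s\}=\{e\in\mathsf{E}\mid es=se=s\}$. A right $S$-module $X$ is unital if $XS=X$; similarly on the left; a bimodule is unital if it is unital on both sides. $\mathscr{Z}(-)$ denotes the center of a ring; $U(A)$ is the group of units of a unital ring $A$. $\mathbf{Pic}(S)$ is the group of isomorphism classes $[P]$ of unital $S$-bimodules $P$ for which there is a unital $S$-bimodule $Q$ with $S$-bimodule isomorphisms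 $Q\otimes_SP\cong S\cong P\otimes_SQ$; the product is $[P][P']=[P\otimes_SP']$ and the neutral element is $[S]$. $\mathbf{Aut}_{S-R}(S)$ is the group, under composition, of all $(S,R)$-bimodule automorphisms of $S$ (left $S$-linear, right $R$-linear). $\mathbf{Aut}_{R\text{-rings}}(S)$ is the group, under composition, of ring automorphisms of $S$ acting as the identity on $R$. The group homomorphism $\widehat{(-)}:\mathbf{Aut}_{S-R}(S)\to\mathbf{Aut}_{R\text{-rings}}(S)$ sends $\lambda$ to $\widehat\lambda$, $\widehat\lambda(s)=\lambda^{-1}(e)\,s\,\lambda(e)$ for any $e\in Unit\{s\}$ (independent of $e$). The group homomorphism $[S_-]:\mathbf{Aut}_{R\text{-rings}}(S)\to\mathbf{Pic}(S)$ sends $\phi$ to $[S_\phi]$, where $S_\phi$ is the $S$-bimodule with underlying left $S$-module $S$ and right action $m\cdot t=m\phi(t)$. *)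

(* Defs.v *)
From HB Require Import structures.
From mathcomp Require Import all_boot all_algebra.
From mathcomp Require Import boolp classical_sets.
From mathcomp Require Import freeg.

Set Implicit Arguments.
Unset Strict Implicit.
Unset Printing Implicit Defensive.

Import GRing.Theory.
Local Open Scope ring_scope.
Local Open Scope classical_set_scope.
Local Open Scope quotient_scope.

(* The carrier of Pic(S) consists of classes of bimodules, hence lives
   above the one universe shared by all MathComp structures, and the library's
   groupType cannot be used for it. *)

Record grp := Grp {
  gcar :> Type;
  gmul : gcar -> gcar -> gcar;
  gone : gcar;
  ginv : gcar -> gcar;
  gmulA : forall x y z, gmul x (gmul y z) = gmul (gmul x y) z;
  gmul1 : forall x, gmul gone x = x;
  gmulV : forall x, gmul (ginv x) x = gone }.

Arguments gone {g}.

Section GroupTheory.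
Variable G : grp.

Lemma gmulI (x y z : G) : gmul x y = gmul x z -> y = z.
Proof. by move=> /(congr1 (gmul (ginv x))); rewrite !gmulA gmulV !gmul1. Qed.

Lemma gmulx1 (x : G) : gmul x gone = x.
Proof. by apply: (@gmulI (ginv x)); rewrite gmulA gmulV gmul1. Qed.

End GroupTheory.

Record ghom (G H : grp) := Ghom {
  gfun :> G -> H;
  gfunM : forall x y, gfun (gmul x y) = gmul (gfun x) (gfun y) }.

Lemma gfun1 (G H : grp) (f : ghom G H) : f gone = gone.
Proof. by apply: (@gmulI _ (f gone)); rewrite -gfunM gmul1 gmulx1. Qed.

Lemma gfunV (G H : grp) (f : ghom G H) x : f (ginv x) = ginv (f x).
Proof.
rewrite -[f _]gmul1 -(gmulV (f x)) -gmulA -gfunM.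
suff -> : gmul x (ginv x) = gone by rewrite gfun1 gmulx1.
by apply: (@gmulI _ (ginv x)); rewrite gmulA gmulV gmul1 gmulx1.
Qed.

Section Kernel.
Variables (G H : grp) (f : ghom G H).

Definition ker_car := {x : G | f x = gone}.

Lemma ker_eq (x y : ker_car) : sval x = sval y -> x = y.
Proof. by case: x y => [x hx] [y hy] /= xy; subst y; congr exist. Qed.

Definition ker_mul (x y : ker_car) : ker_car.
Proof.
exists (gmul (sval x) (sval y)).
by rewrite gfunM (svalP x) (svalP y) gmul1.
Defined.

Definition ker_one : ker_car := exist _ gone (gfun1 f).

Definition ker_inv (x : ker_car) : ker_car.
Proof.
exists (ginv (sval x)).
by rewrite gfunV (svalP x) -[LHS]gmulx1 gmulV.
Defined.

Definition Ker : grp.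
Proof.
apply: (@Grp ker_car ker_mul ker_one ker_inv).
- by move=> x y z; apply: ker_eq; rewrite /= gmulA.
- by move=> x; apply: ker_eq; rewrite /= gmul1.
- by move=> x; apply: ker_eq; rewrite /= gmulV.
Defined.

Definition ker_incl : ghom Ker G := @Ghom Ker G (fun x => sval x) (fun _ _ => erefl).

End Kernel.

Definition grp1 : grp :=
  @Grp unit (fun _ _ => tt) tt (fun _ => tt) (fun _ _ _ => erefl)
    (fun x => let: tt := x in erefl) (fun _ => erefl).

Definition hom_from1 (G : grp) : ghom grp1 G :=
  @Ghom grp1 G (fun _ => gone) (fun _ _ => esym (gmul1 gone)).

Definition exact_at (A B C : grp) (f : ghom A B) (g : ghom B C) : Prop :=
  forall y : B, (exists x : A, f x = y) <-> g y = gone.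

HB.mixin Record Zmodule_isNuRing S of GRing.Zmodule S := {
  numul : S -> S -> S;
  numulA : associative numul;
  numulDl : left_distributive numul +%R;
  numulDr : right_distributive numul +%R }.

#[short(type="nuRingType")]
HB.structure Definition NuRing := {S of Zmodule_isNuRing S & GRing.Zmodule S}.

Notation "x ** y" := (numul x y) (at level 40, left associativity) : ring_scope.

Section Rings.
Variable S : nuRingType.
Implicit Types (A E R : set S) (s t e : S).

Lemma numul0r s : 0 ** s = 0.
Proof. by apply: (addrI (0 ** s)); rewrite -numulDl !addr0. Qed.

Lemma numulr0 s : s ** 0 = 0.
Proof. by apply: (addrI (s ** 0)); rewrite -numulDr !addr0. Qed.

Record subring A : Prop := Subring {
  subring0 : A 0;
  subringB : forall s t, A s -> A t -> A (s - t);
  subringM : forall s t, A s -> A t -> A (s ** t) }.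

Record local_units E A : Prop := LocalUnits {
  lu_sub : E `<=` A;
  lu_idem : forall e, E e -> e ** e = e;
  lu_fin : forall rs : seq S, (forall r, r \in rs -> A r) ->
    exists2 e, E e & forall r, r \in rs -> e ** r = r /\ r ** e = r }.

Definition has_local_units : Prop := exists E, local_units E setT.

Record lu_extension R E : Prop := LuExtension {
  ext_subring : subring R;
  ext_base : local_units E R;
  ext_top : local_units E setT }.

Lemma ext_has_lu R E : lu_extension R E -> has_local_units.
Proof. by case=> _ _ h; exists E. Qed.

Definition Unit E s : set S := [set e | E e /\ (e ** s = s /\ s ** e = s)].

Definition corner e : set S := [set x | exists s, x = e ** s ** e].

Definition center A : set S :=
  [set z | A z /\ forall a, A a -> z ** a = a ** z].

(* U(A) for a ring A with identity element u *)
Definition units A u : set S :=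
  [set x | A x /\ exists2 y, A y & x ** y = u /\ y ** x = u].

End Rings.

Section AutBimod.
Variables (S : nuRingType) (A : set S).

Record aut_bimod := AutBimod {
  ab_fun :> S -> S;
  ab_inv : S -> S;
  ab_funK : cancel ab_fun ab_inv;
  ab_invK : cancel ab_inv ab_fun;
  ab_add : forall s t, ab_fun (s + t) = ab_fun s + ab_fun t;
  ab_left : forall s t, ab_fun (s ** t) = s ** ab_fun t;
  ab_right : forall s a, A a -> ab_fun (s ** a) = ab_fun s ** a }.

Lemma ab_eq (l m : aut_bimod) : l =1 m -> l = m.
Proof.
case: l m => [f f' fK f'K fD fl fr] [g g' gK g'K gD gl gr] /= fg.
have E : f = g by apply/funext.
subst g; have E' : f' = g' by apply/funext => x; rewrite -{1}(g'K x) fK.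
by subst g'; congr AutBimod; exact: Prop_irrelevance.
Qed.

Lemma ab_inv_left (l : aut_bimod) s t : ab_inv l (s ** t) = s ** ab_inv l t.
Proof. by rewrite -{1}(ab_invK l t) -ab_left ab_funK. Qed.

Lemma ab_inv_right (l : aut_bimod) s a :
  A a -> ab_inv l (s ** a) = ab_inv l s ** a.
Proof. by move=> Aa; rewrite -{1}(ab_invK l s) -ab_right // ab_funK. Qed.

Definition ab_mul (l m : aut_bimod) : aut_bimod.
Proof.
apply: (@AutBimod (l \o m) (ab_inv m \o ab_inv l)).
- by move=> s /=; rewrite !ab_funK.
- by move=> s /=; rewrite !ab_invK.
- by move=> s t /=; rewrite !ab_add.
- by move=> s t /=; rewrite !ab_left.
- by move=> s a Aa /=; rewrite !ab_right.
Defined.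

Definition ab_one : aut_bimod :=
  @AutBimod id id (fun _ => erefl) (fun _ => erefl) (fun _ _ => erefl)
    (fun _ _ => erefl) (fun _ _ _ => erefl).

Definition ab_invg (l : aut_bimod) : aut_bimod.
Proof.
apply: (@AutBimod (ab_inv l) l (ab_invK l) (ab_funK l)).
- move=> s t; rewrite -{1}(ab_invK l s) -{1}(ab_invK l t) -ab_add.
  exact: ab_funK.
- exact: ab_inv_left.
- exact: ab_inv_right.
Defined.

Definition Aut_bimod : grp.
Proof.
apply: (@Grp aut_bimod ab_mul ab_one ab_invg).
- by move=> l m n; apply: ab_eq.
- by move=> l; apply: ab_eq.
- by move=> l; apply: ab_eq => s /=; rewrite ab_funK.
Defined.

End AutBimod.

(* An automorphism of S as an S-bimodule, seen as an (S, R)-bimodule one *)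
Section Restrict.
Variables (S : nuRingType) (R : set S).

Definition ab_restrict (l : aut_bimod [set: S]) : aut_bimod R :=
  AutBimod (ab_funK l) (ab_invK l) (ab_add l) (ab_left l)
    (fun s a _ => ab_right l s (I : [set: S] a)).

Definition bimod_restrict : ghom (Aut_bimod [set: S]) (Aut_bimod R).
Proof.
apply: (@Ghom (Aut_bimod [set: S]) (Aut_bimod R) ab_restrict).
by move=> l m; apply: ab_eq.
Defined.

Lemma ab_restrict_inj : injective ab_restrict.
Proof. by move=> l m h; apply: ab_eq => s; rewrite -[l s]/(ab_restrict l s) h. Qed.

End Restrict.

Section AutRing.
Variables (S : nuRingType) (R : set S).

Record aut_ring := AutRing {
  ar_fun :> S -> S;
  ar_inv : S -> S;
  ar_funK : cancel ar_fun ar_inv;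
  ar_invK : cancel ar_inv ar_fun;
  ar_add : forall s t, ar_fun (s + t) = ar_fun s + ar_fun t;
  ar_mul : forall s t, ar_fun (s ** t) = ar_fun s ** ar_fun t;
  ar_fix : forall r, R r -> ar_fun r = r }.

Lemma ar_eq (f g : aut_ring) : f =1 g -> f = g.
Proof.
case: f g => [f f' fK f'K fD fl fr] [g g' gK g'K gD gl gr] /= fg.
have E : f = g by apply/funext.
subst g; have E' : f' = g' by apply/funext => x; rewrite -{1}(g'K x) fK.
by subst g'; congr AutRing; exact: Prop_irrelevance.
Qed.

Definition ar_comp (f g : aut_ring) : aut_ring.
Proof.
apply: (@AutRing (f \o g) (ar_inv g \o ar_inv f)).
- by move=> s /=; rewrite !ar_funK.
- by move=> s /=; rewrite !ar_invK.
- by move=> s t /=; rewrite !ar_add.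
- by move=> s t /=; rewrite !ar_mul.
- by move=> r Rr /=; rewrite !ar_fix.
Defined.

Definition ar_one : aut_ring :=
  @AutRing id id (fun _ => erefl) (fun _ => erefl) (fun _ _ => erefl)
    (fun _ _ => erefl) (fun _ _ => erefl).

Definition ar_invg (f : aut_ring) : aut_ring.
Proof.
apply: (@AutRing (ar_inv f) f (ar_invK f) (ar_funK f)).
- by move=> s t; rewrite -{1}(ar_invK f s) -{1}(ar_invK f t) -ar_add ar_funK.
- by move=> s t; rewrite -{1}(ar_invK f s) -{1}(ar_invK f t) -ar_mul ar_funK.
- by move=> r Rr; rewrite -{1}(ar_fix f Rr) ar_funK.
Defined.

Definition Aut_rings : grp.
Proof.
apply: (@Grp aut_ring ar_comp ar_one ar_invg).
- by move=> l m n; apply: ar_eq.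
- by move=> l; apply: ar_eq.
- by move=> l; apply: ar_eq => s /=; rewrite ar_funK.
Defined.

End AutRing.

Section Hat.
Variables (S : nuRingType) (R E : set S) (X : lu_extension R E).
Implicit Types l m : aut_bimod R.

Lemma Unit_ex (s : S) : exists e, Unit E s e.
Proof.
have [//|e Ee he] := lu_fin (ext_top X) (rs := [:: s]).
by exists e; split => //; apply: he; rewrite mem_head.
Qed.

(* hat_fun uses an arbitrary e in Unit{s}; hat_funE shows that any other
   choice gives the same value. *)
Definition Unit_pick (s : S) : S := sval (cid (Unit_ex s)).

Lemma Unit_pickP s : Unit E s (Unit_pick s).
Proof. exact: svalP (cid (Unit_ex s)). Qed.

Definition hat_fun l (s : S) : S :=
  let e := Unit_pick s in ab_inv l e ** s ** l e.


Lemma ab_inv_unit l s e k :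
  R e -> e ** s = s -> k ** e = e -> ab_inv l k ** s = ab_inv l e ** s.
Proof. by move=> Re es ke; rewrite -{1}es numulA -ab_inv_right // ke. Qed.

Lemma Unit_common s t : exists e, Unit E s e /\ Unit E t e.
Proof.
have [//|e Ee he] := lu_fin (ext_top X) (rs := [:: s; t]).
by exists e; split; split => //; apply: he; rewrite !inE eqxx ?orbT.
Qed.

Lemma Unit_R s e : Unit E s e -> R e.
Proof. by case=> Ee _; apply: (lu_sub (ext_base X)). Qed.

Lemma Unit_self s e : Unit E s e -> Unit E e e.
Proof. by case=> Ee _; split=> //; rewrite (lu_idem (ext_base X)). Qed.

Lemma Unit_trans s e k : Unit E s e -> Unit E e k -> Unit E s k.
Proof.
move=> [_ [es se]] [Ek [ke ek]]; split=> //; split.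
  by rewrite -{1}es numulA ke.
by rewrite -{1}se -numulA ek.
Qed.

Lemma hat_funE l s e : Unit E s e -> hat_fun l s = ab_inv l e ** s ** l e.
Proof.
rewrite /hat_fun; move: (Unit_pick s) (Unit_pickP s) => f uf ue.
have [k [uke ukf]] := Unit_common e f.
have H g : Unit E s g -> Unit E g k ->
    ab_inv l g ** s ** l g = ab_inv l k ** s ** l k.
  move=> ug [Ek [kg gk]]; have [Eg [gs sg]] := ug.
  rewrite (ab_inv_unit l (Unit_R ug) gs kg) -!numulA -!ab_left sg.
  by have [_ [_ ->]] := Unit_trans ug (conj Ek (conj kg gk)).
by rewrite /= (H f) // (H e).
Qed.

Lemma hat_funE' l s e : Unit E s e -> hat_fun l s = ab_inv l e ** l s.
Proof. by move=> u; rewrite (hat_funE _ u) -numulA -ab_left; case: u => _ [_ ->]. Qed.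

Lemma ab_mulV l e : R e -> e ** e = e -> l e ** ab_inv l e = e.
Proof. by move=> Re ee; rewrite -ab_inv_left -ab_right // ee ab_funK. Qed.

Lemma ab_mulV' l e : R e -> e ** e = e -> ab_inv l e ** l e = e.
Proof. by move=> Re ee; rewrite -ab_left -ab_inv_right // ee ab_invK. Qed.

Lemma hat_add l s t : hat_fun l (s + t) = hat_fun l s + hat_fun l t.
Proof.
have [e [us ut]] := Unit_common s t.
have u : Unit E (s + t) e.
  case: us ut => Ee [es se] [_ [et te]]; split=> //.
  by rewrite numulDl numulDr es se et te.
by rewrite (hat_funE l u) (hat_funE l us) (hat_funE l ut) numulDr numulDl.
Qed.

Lemma Unit_mul s t e : Unit E s e -> Unit E t e -> Unit E (s ** t) e.
Proof.
move=> [Ee [es se]] [_ [et te]]; split=> //.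
by rewrite numulA es -numulA te.
Qed.

Lemma hat_mul l s t : hat_fun l (s ** t) = hat_fun l s ** hat_fun l t.
Proof.
have [e [us ut]] := Unit_common s t.
rewrite (hat_funE l (Unit_mul us ut)) (hat_funE l us) (hat_funE l ut).
have Re := Unit_R us; have [Ee [_ se]] := us.
have ee := lu_idem (ext_base X) Ee.
rewrite !numulA -[_ ** _ ** l e ** _]numulA ab_mulV //.
by rewrite -[_ ** _ ** e]numulA se.
Qed.

Lemma hat_fix l r : R r -> hat_fun l r = r.
Proof.
move=> Rr; have [e ue] := Unit_ex r.
have Re := Unit_R ue; have [Ee [er re]] := ue.
have ee := lu_idem (ext_base X) Ee.
by rewrite (hat_funE' _ ue) -{1}er ab_right // numulA ab_mulV'.
Qed.

Lemma Unit_hat l s e : Unit E s e -> Unit E (hat_fun l s) e.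
Proof.
move=> u; rewrite (hat_funE _ u).
have Re := Unit_R u; have [Ee _] := u.
have ee := lu_idem (ext_base X) Ee.
split=> //; split; first by rewrite !numulA -ab_inv_left ee.
by rewrite -numulA -ab_right // ee.
Qed.

Lemma hat_comp l m s : hat_fun (ab_mul l m) s = hat_fun l (hat_fun m s).
Proof.
have [e u] := Unit_ex s.
rewrite (hat_funE _ u) (hat_funE l (Unit_hat m u)) (hat_funE m u) /=.
have Re := Unit_R u; have [Ee _] := u.
have ee := lu_idem (ext_base X) Ee.
have -> : l (m e) = m e ** l e by rewrite -ab_left -ab_right // ee.
have -> : ab_inv m (ab_inv l e) = ab_inv l e ** ab_inv m e.
  by rewrite -ab_inv_left -ab_inv_right // ee.
by rewrite !numulA.
Qed.

Lemma hat_one s : hat_fun (ab_one R) s = s.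
Proof. by have [e u] := Unit_ex s; rewrite (hat_funE _ u) /=; case: u => _ [-> ->]. Qed.

Lemma hat_funK l : cancel (hat_fun l) (hat_fun (ab_invg l)).
Proof.
move=> s; rewrite -hat_comp -[RHS]hat_one; congr (hat_fun _ s).
by apply: ab_eq => t /=; rewrite ab_funK.
Qed.

Lemma hat_invK l : cancel (hat_fun (ab_invg l)) (hat_fun l).
Proof.
move=> s; rewrite -hat_comp -[RHS]hat_one; congr (hat_fun _ s).
by apply: ab_eq => t /=; rewrite ab_invK.
Qed.

Definition hat_aut l : aut_ring R :=
  AutRing (hat_funK l) (hat_invK l) (hat_add l) (hat_mul l) (@hat_fix l).

Definition hat : ghom (Aut_bimod R) (Aut_rings R).
Proof.
apply: (@Ghom (Aut_bimod R) (Aut_rings R) hat_aut).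
by move=> l m; apply: ar_eq => s; apply: hat_comp.
Defined.

End Hat.

(* lact_unital and ract_unital say SP = P and PS = P, where SP is the additive
   span of the products. *)
Record bimod (S : nuRingType) := Bimod {
  bcar :> zmodType;
  lact : S -> bcar -> bcar;
  ract : bcar -> S -> bcar;
  lactDl : forall s t x, lact (s + t) x = lact s x + lact t x;
  lactDr : forall s x y, lact s (x + y) = lact s x + lact s y;
  lactA : forall s t x, lact (s ** t) x = lact s (lact t x);
  ractDl : forall x y s, ract (x + y) s = ract x s + ract y s;
  ractDr : forall x s t, ract x (s + t) = ract x s + ract x t;
  ractA : forall x s t, ract x (s ** t) = ract (ract x s) t;
  lractA : forall s x t, lact s (ract x t) = ract (lact s x) t;
  lact_unital : forall x, exists l : seq (S * bcar),
    x = \sum_(i <- l) lact i.1 i.2;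
  ract_unital : forall x, exists l : seq (bcar * S),
    x = \sum_(i <- l) ract i.1 i.2 }.

Record bimod_iso_map (S : nuRingType) (P Q : bimod S) (f : P -> Q) : Prop :=
  BimodIsoMap {
  bi_add : forall x y, f (x + y) = f x + f y;
  bi_lact : forall s x, f (lact s x) = lact s (f x);
  bi_ract : forall x s, f (ract x s) = ract (f x) s;
  bi_bij : bijective f }.

Definition bimod_iso (S : nuRingType) (P Q : bimod S) : Prop :=
  exists f : P -> Q, bimod_iso_map f.

Section BimodIso.
Variable S : nuRingType.
Implicit Types P Q T : bimod S.

Lemma iso_refl P : bimod_iso P P.
Proof. by exists id; split=> //; exists id. Qed.

Lemma iso_sym P Q : bimod_iso P Q -> bimod_iso Q P.
Proof.
move=> [f [fD fl fr [g fK gK]]]; exists g; split; last by exists f.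
- by move=> x y; rewrite -{1}(gK x) -{1}(gK y) -fD fK.
- by move=> s x; rewrite -{1}(gK x) -fl fK.
- by move=> x s; rewrite -{1}(gK x) -fr fK.
Qed.

Lemma iso_trans P Q T : bimod_iso P Q -> bimod_iso Q T -> bimod_iso P T.
Proof.
move=> [f [fD fl fr fb]] [g [gD gl gr gb]]; exists (g \o f); split.
- by move=> x y /=; rewrite fD gD.
- by move=> s x /=; rewrite fl gl.
- by move=> x s /=; rewrite fr gr.
- exact: bij_comp.
Qed.

End BimodIso.

(* The tensor product over S is the free abelian group on P * Q modulo the
   subgroup generated by the relators; tens_null is membership in that subgroup,
   written as the intersection of all subgroups containing the relators. *)

Section Tensor.
Variables (S : nuRingType) (P Q : bimod S).
Let F := {freeg (P * Q)%type / int}.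

Variant tens_relator : F -> Prop :=
| TensDl p p' q :
    tens_relator (<< (p + p', q) >> - << (p, q) >> - << (p', q) >>)
| TensDr p q q' :
    tens_relator (<< (p, q + q') >> - << (p, q) >> - << (p, q') >>)
| TensM p s q : tens_relator (<< (ract p s, q) >> - << (p, lact s q) >>).

Definition tens_null (x : F) : Prop :=
  forall H : F -> Prop, H 0 -> (forall y z, H y -> H z -> H (y - z)) ->
    (forall y, tens_relator y -> H y) -> H x.

Definition tens_ker : {pred F} := fun x => `[< tens_null x >].

Lemma tens_ker_closed : zmod_closed tens_ker.
Proof.
split; first by apply/asboolP => H.
move=> x y /asboolP hx /asboolP hy; apply/asboolP => H H0 HB Hr.
exact: (HB _ _ (hx H H0 HB Hr) (hy H H0 HB Hr)).
Qed.

HB.instance Definition _ := GRing.isZmodClosed.Build F tens_ker tens_ker_closed.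

Definition tens : zmodType := Quotient.quot tens_ker.

Definition pt (p : P) (q : Q) : tens := \pi_(Quotient.quot tens_ker) << (p, q) >>.

Lemma tens_rel0 x : tens_relator x -> \pi_(Quotient.quot tens_ker) x = 0.
Proof.
move=> hx; apply/eqP; rewrite -[0](raddf0 (\pi_(Quotient.quot tens_ker))).
rewrite -Quotient.idealrBE subr0; apply/asboolP => H _ _; exact.
Qed.

Lemma ptDl p p' q : pt (p + p') q = pt p q + pt p' q.
Proof.
have /tens_rel0 := TensDl p p' q; rewrite !raddfB => /eqP.
by rewrite -addrA -opprD subr_eq0 => /eqP.
Qed.

Lemma ptDr p q q' : pt p (q + q') = pt p q + pt p q'.
Proof.
have /tens_rel0 := TensDr p q q'; rewrite !raddfB => /eqP.
by rewrite -addrA -opprD subr_eq0 => /eqP.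
Qed.

Lemma ptM p s q : pt (ract p s) q = pt p (lact s q).
Proof.
by have /tens_rel0 := TensM p s q; rewrite !raddfB => /eqP; rewrite subr_eq0 => /eqP.
Qed.

Lemma tens_ind (H : tens -> Prop) :
  H 0 -> (forall x y, H x -> H y -> H (x - y)) -> (forall p q, H (pt p q)) ->
  forall t, H t.
Proof.
move=> H0 HB Hp t; rewrite -[t]reprK; move: (repr t) => D {t}.
have HN x : H x -> H (- x) by rewrite -sub0r; apply: HB.
have HD x y : H x -> H y -> H (x + y).
  by move=> hx hy; rewrite -[y]opprK; apply/HB/HN.
rewrite -(freeg_sumE D) raddf_sum /=.
apply: (big_ind H) => // -[p q] _.
rewrite -[coeff _ _]intz -freegU_mulz raddfMz -/(pt p q).
have Hn n : H (pt p q *+ n).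
  by elim: n => [|n IHn]; rewrite ?mulr0n // mulrS; apply: HD => //; apply: Hp.
by case: (coeff _ _) => n; rewrite ?NegzE ?mulrNz -pmulrn //; apply: HN.
Qed.

Section Lift.
Variables (A : zmodType) (f : P -> Q -> A).
Hypothesis fDl : forall p p' q, f (p + p') q = f p q + f p' q.
Hypothesis fDr : forall p q q', f p (q + q') = f p q + f p q'.
Hypothesis fM : forall p s q, f (ract p s) q = f p (lact s q).

Definition flift (D : F) : A :=
  fglift (fun z : P * Q => f z.1 z.2 : zmodule A) D.

Lemma fliftB x y : flift (x - y) = flift x - flift y.
Proof. exact: (lift_is_additive (fun z : P * Q => f z.1 z.2 : zmodule A) x y). Qed.

Lemma fliftU p q : flift << (p, q) >> = f p q.
Proof. by rewrite /flift liftU scale1r. Qed.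

Lemma flift_null x : tens_null x -> flift x = 0.
Proof.
move=> /(_ (fun x => flift x = 0)); apply=> [|y z hy hz|y].
- by rewrite -(subr0 (0 : F)) fliftB subrr.
- by rewrite fliftB hy hz subrr.
- case=> [p p' q|p q q'|p s q]; rewrite !fliftB !fliftU.
  + by rewrite fDl addrAC addrK subrr.
  + by rewrite fDr addrAC addrK subrr.
  + by rewrite fM subrr.
Qed.

Definition tlift (t : tens) : A := flift (repr t).

Lemma tliftE D : tlift (\pi_(Quotient.quot tens_ker) D) = flift D.
Proof.
apply/eqP; rewrite -subr_eq0 -fliftB; apply/eqP/flift_null/asboolP.
suff : repr (\pi_(Quotient.quot tens_ker) D) - D \in tens_ker by [].
by rewrite Quotient.idealrBE reprK.
Qed.

Lemma tliftB x y : tlift (x - y) = tlift x - tlift y.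
Proof.
by rewrite -[x in LHS]reprK -[y in LHS]reprK -raddfB tliftE fliftB.
Qed.

Lemma tlift0 : tlift 0 = 0.
Proof. by rewrite -(subrr 0) tliftB subrr. Qed.

Lemma tliftD x y : tlift (x + y) = tlift x + tlift y.
Proof. by rewrite -[y in LHS]opprK -[- y]sub0r !tliftB tlift0 sub0r opprK. Qed.

Lemma tlift_pt p q : tlift (pt p q) = f p q.
Proof. by rewrite tliftE fliftU. Qed.

End Lift.

End Tensor.

Section TensorBimod.
Variables (S : nuRingType) (P Q : bimod S).
Notation tens := (tens P Q).
Notation pt := (@pt S P Q).

Definition tens_lact (s : S) (t : tens) : tens :=
  tlift (fun p q => pt (lact s p) q) t.

Definition tens_ract (t : tens) (s : S) : tens :=
  tlift (fun p q => pt p (ract q s)) t.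

Lemma tens_lact_pt s p q : tens_lact s (pt p q) = pt (lact s p) q.
Proof.
apply: tlift_pt => *; first by rewrite lactDr ptDl.
  by rewrite ptDr.
by rewrite lractA ptM.
Qed.

Lemma tens_ract_pt p q s : tens_ract (pt p q) s = pt p (ract q s).
Proof.
apply: tlift_pt => *; first by rewrite ptDl.
  by rewrite ractDl ptDr.
by rewrite -lractA ptM.
Qed.

Lemma tens_lactB s x y : tens_lact s (x - y) = tens_lact s x - tens_lact s y.
Proof.
apply: tliftB => *; first by rewrite lactDr ptDl.
  by rewrite ptDr.
by rewrite lractA ptM.
Qed.

Lemma tens_ractB x y s : tens_ract (x - y) s = tens_ract x s - tens_ract y s.
Proof.
apply: tliftB => *; first by rewrite ptDl.
  by rewrite ractDl ptDr.
by rewrite -lractA ptM.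
Qed.

Lemma subD_of_B (A B : zmodType) (f : A -> B) :
  (forall x y, f (x - y) = f x - f y) -> forall x y, f (x + y) = f x + f y.
Proof.
move=> fB; have f0 : f 0 = 0 by rewrite -(subrr 0) fB subrr.
by move=> x y; rewrite -[y in LHS]opprK -[- y]sub0r !fB f0 sub0r opprK.
Qed.

Lemma tens_ext (A : zmodType) (f g : tens -> A) :
  (forall x y, f (x - y) = f x - f y) -> (forall x y, g (x - y) = g x - g y) ->
  (forall p q, f (pt p q) = g (pt p q)) -> f =1 g.
Proof.
move=> fB gB fg; apply: tens_ind => //; first by rewrite -(subrr 0) fB gB !subrr.
by move=> x y hx hy; rewrite fB gB hx hy.
Qed.

Lemma pt_suml (I : Type) (l : seq I) (F : I -> P) q :
  pt (\sum_(i <- l) F i) q = \sum_(i <- l) pt (F i) q.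
Proof.
elim: l => [|i l IHl]; last by rewrite !big_cons ptDl IHl.
by rewrite !big_nil; apply: (addrI (pt 0 q)); rewrite -ptDl !addr0.
Qed.

Lemma pt_sumr (I : Type) (l : seq I) p (F : I -> Q) :
  pt p (\sum_(i <- l) F i) = \sum_(i <- l) pt p (F i).
Proof.
elim: l => [|i l IHl]; last by rewrite !big_cons ptDr IHl.
by rewrite !big_nil; apply: (addrI (pt p 0)); rewrite -ptDr !addr0.
Qed.

Definition tensor : bimod S.
Proof.
apply: (@Bimod S tens tens_lact tens_ract).
- move=> s t x; move: x; apply: tens_ext => [x y|x y|p q].
  + exact: tens_lactB.
  + by rewrite !tens_lactB addrACA opprD.
  + by rewrite !tens_lact_pt lactDl ptDl.
- by move=> s; apply: subD_of_B; exact: tens_lactB.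
- move=> s t x; move: x; apply: tens_ext => [x y|x y|p q].
  + exact: tens_lactB.
  + by rewrite !tens_lactB.
  + by rewrite !tens_lact_pt lactA.
- by move=> x y s; exact: (subD_of_B (f := tens_ract^~ s) (fun u v => tens_ractB u v s)).
- move=> x s t; move: x; apply: tens_ext => [x y|x y|p q].
  + exact: tens_ractB.
  + by rewrite !tens_ractB addrACA opprD.
  + by rewrite !tens_ract_pt ractDr ptDr.
- move=> x s t; move: x; apply: tens_ext => [x y|x y|p q].
  + exact: tens_ractB.
  + by rewrite !tens_ractB.
  + by rewrite !tens_ract_pt ractA.
- move=> s x t; move: x; apply: tens_ext => [x y|x y|p q].
  + by rewrite tens_ractB tens_lactB.
  + by rewrite tens_lactB tens_ractB.
  + by rewrite tens_ract_pt !tens_lact_pt tens_ract_pt.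
- apply: tens_ind => [|x y [lx hx] [ly hy]|p q].
  + by exists [::]; rewrite big_nil.
  + exists (lx ++ [seq (i.1, - i.2) | i <- ly]).
    rewrite big_cat big_map /= hx hy -sumrN; congr (_ + _).
    apply: eq_bigr => i _ /=.
    by rewrite -[- i.2]sub0r tens_lactB -{1}(subrr 0) tens_lactB subrr sub0r.
  + have [l hl] := lact_unital p; exists [seq (i.1, pt i.2 q) | i <- l].
    by rewrite big_map hl pt_suml; apply: eq_bigr => i _; rewrite tens_lact_pt.
- apply: tens_ind => [|x y [lx hx] [ly hy]|p q].
  + by exists [::]; rewrite big_nil.
  + exists (lx ++ [seq (- i.1, i.2) | i <- ly]).
    rewrite big_cat big_map /= hx hy -sumrN; congr (_ + _).
    apply: eq_bigr => i _ /=.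
    by rewrite -[- i.1]sub0r tens_ractB -{1}(subrr 0) tens_ractB subrr sub0r.
  + have [l hl] := ract_unital q; exists [seq (pt p i.1, i.2) | i <- l].
    by rewrite big_map hl pt_sumr; apply: eq_bigr => i _; rewrite tens_ract_pt.
Defined.

End TensorBimod.

Section IsoTensor.
Variable S : nuRingType.
Implicit Types P Q T : bimod S.

Lemma iso0 P Q (f : P -> Q) : bimod_iso_map f -> f 0 = 0.
Proof. by case=> fD _ _ _; apply: (addrI (f 0)); rewrite -fD !addr0. Qed.

Lemma tens_map P P' Q Q' (f : P -> P') (g : Q -> Q') :
  bimod_iso_map f -> bimod_iso_map g ->
  exists2 h : tensor P Q -> tensor P' Q',
    (forall x y, h (x - y) = h x - h y) & forall p q, h (pt p q) = pt (f p) (g q).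
Proof.
move=> [fD fl fr _] [gD gl gr _].
exists (tlift (fun p q => pt (f p) (g q) : tensor P' Q')).
  apply: tliftB => *; first by rewrite fD ptDl.
    by rewrite gD ptDr.
  by rewrite fr gl ptM.
apply: tlift_pt => *; first by rewrite fD ptDl.
  by rewrite gD ptDr.
by rewrite fr gl ptM.
Qed.

Lemma iso_tensor P P' Q Q' :
  bimod_iso P P' -> bimod_iso Q Q' -> bimod_iso (tensor P Q) (tensor P' Q').
Proof.
move=> [f hf] [g hg].
have [_ fl _ [f' fK f'K]] := hf; have [_ _ gr [g' gK g'K]] := hg.
have hf' : bimod_iso_map f'.
  case: hf => [fD _ fr _]; split; last by exists f.
  - by move=> x y; rewrite -{1}(f'K x) -{1}(f'K y) -fD fK.
  - by move=> s x; rewrite -{1}(f'K x) -fl fK.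
  - by move=> x s; rewrite -{1}(f'K x) -fr fK.
have hg' : bimod_iso_map g'.
  case: hg => [gD gl _ _]; split; last by exists g.
  - by move=> x y; rewrite -{1}(g'K x) -{1}(g'K y) -gD gK.
  - by move=> s x; rewrite -{1}(g'K x) -gl gK.
  - by move=> x s; rewrite -{1}(g'K x) -gr gK.
have [h hB hp] := tens_map hf hg; have [k kB kp] := tens_map hf' hg'.
exists h; split.
- exact: subD_of_B.
- move=> s; apply: tens_ext => [x y|x y|p q].
  + by rewrite [lact _ _]tens_lactB hB.
  + by rewrite hB [LHS]tens_lactB.
  + by rewrite [lact _ _]tens_lact_pt !hp [RHS]tens_lact_pt fl.
- move=> x s; move: x; apply: tens_ext => [x y|x y|p q].
  + by rewrite [ract _ _]tens_ractB hB.
  + by rewrite hB [LHS]tens_ractB.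
  + by rewrite [ract _ _]tens_ract_pt !hp [RHS]tens_ract_pt gr.
- exists k.
  + apply: tens_ext => [x y|x y|p q] //; first by rewrite hB kB.
    by rewrite hp kp fK gK.
  + apply: tens_ext => [x y|x y|p q] //; first by rewrite kB hB.
    by rewrite kp hp f'K g'K.
Qed.

Lemma ptBl P Q (p p' : P) (q : Q) : pt (p - p') q = pt p q - pt p' q.
Proof. by apply/eqP; rewrite eq_sym subr_eq -ptDl subrK. Qed.

Lemma ptBr P Q (p : P) (q q' : Q) : pt p (q - q') = pt p q - pt p q'.
Proof. by apply/eqP; rewrite eq_sym subr_eq -ptDr subrK. Qed.

Section Assoc.
Variables P Q T : bimod S.

Lemma assoc_map : exists2 h : tensor (tensor P Q) T -> tensor P (tensor Q T),
  (forall x y, h (x - y) = h x - h y) &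
  forall p q t, h (pt (pt p q : tensor P Q) t) = pt p (pt q t : tensor Q T).
Proof.
pose h1 (t : T) (x : tensor P Q) : tensor P (tensor Q T) :=
  tlift (fun p q => pt p (pt q t : tensor Q T) : tensor P (tensor Q T)) x.
have h1p t p q : h1 t (pt p q) = pt p (pt q t : tensor Q T).
  apply: tlift_pt => *; first by rewrite ptDl.
    by rewrite ptDl ptDr.
  by rewrite ptM; congr pt; exact: tens_lact_pt.
have h1B t x y : h1 t (x - y) = h1 t x - h1 t y.
  apply: tliftB => *; first by rewrite ptDl.
    by rewrite ptDl ptDr.
  by rewrite ptM; congr pt; exact: tens_lact_pt.
have h2Dl x x' t : h1 t (x + x') = h1 t x + h1 t x' by apply: subD_of_B.
have h2Dr x t t' : h1 (t + t') x = h1 t x + h1 t' x.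
  move: x; apply: tens_ext => // [x y|p q].
    by rewrite !h1B addrACA opprD.
  by rewrite !h1p -ptDr -ptDr.
have h2M x s t : h1 t (ract x s) = h1 (lact s t) x.
  move: x; apply: tens_ext => // [x y|p q].
    by rewrite [ract _ _]tens_ractB h1B.
  by rewrite [ract _ _]tens_ract_pt !h1p ptM.
exists (tlift (fun x t => h1 t x)); first exact: tliftB.
by move=> p q t; rewrite tlift_pt.
Qed.

Lemma assoc_map' : exists2 h : tensor P (tensor Q T) -> tensor (tensor P Q) T,
  (forall x y, h (x - y) = h x - h y) &
  forall p q t, h (pt p (pt q t : tensor Q T)) = pt (pt p q : tensor P Q) t.
Proof.
pose h1 (p : P) (x : tensor Q T) : tensor (tensor P Q) T :=
  tlift (fun q t => pt (pt p q : tensor P Q) t : tensor (tensor P Q) T) x.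
have h1p p q t : h1 p (pt q t) = pt (pt p q : tensor P Q) t.
  apply: tlift_pt => *; first by rewrite ptDr ptDl.
    by rewrite ptDr.
  by rewrite -ptM; congr pt; exact/esym/tens_ract_pt.
have h1B p x y : h1 p (x - y) = h1 p x - h1 p y.
  apply: tliftB => *; first by rewrite ptDr ptDl.
    by rewrite ptDr.
  by rewrite -ptM; congr pt; exact/esym/tens_ract_pt.
have h2Dr p x x' : h1 p (x + x') = h1 p x + h1 p x' by apply: subD_of_B.
have h2Dl p p' x : h1 (p + p') x = h1 p x + h1 p' x.
  move: x; apply: tens_ext => // [x y|q t].
    by rewrite !h1B addrACA opprD.
  by rewrite !h1p -ptDl -ptDl.
have h2M p s x : h1 (ract p s) x = h1 p (lact s x).
  move: x; apply: tens_ext => // [x y|q t].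
    by rewrite [lact _ _]tens_lactB h1B.
  by rewrite [lact _ _]tens_lact_pt !h1p ptM.
exists (tlift h1); first exact: tliftB.
by move=> p q t; rewrite tlift_pt.
Qed.

Lemma tens_ext3l (A : zmodType) (f g : tensor (tensor P Q) T -> A) :
  (forall x y, f (x - y) = f x - f y) -> (forall x y, g (x - y) = g x - g y) ->
  (forall p q t, f (pt (pt p q : tensor P Q) t) = g (pt (pt p q : tensor P Q) t)) ->
  f =1 g.
Proof.
move=> fB gB fg; apply: tens_ext => // x t; move: x.
by apply: tens_ext => [x y|x y|p q]; rewrite ?ptBl ?fB ?gB.
Qed.

Lemma tens_ext3r (A : zmodType) (f g : tensor P (tensor Q T) -> A) :
  (forall x y, f (x - y) = f x - f y) -> (forall x y, g (x - y) = g x - g y) ->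
  (forall p q t, f (pt p (pt q t : tensor Q T)) = g (pt p (pt q t : tensor Q T))) ->
  f =1 g.
Proof.
move=> fB gB fg; apply: tens_ext => // p x; move: x.
by apply: tens_ext => [x y|x y|q t]; rewrite ?ptBr ?fB ?gB.
Qed.

Lemma iso_tensorA : bimod_iso (tensor (tensor P Q) T) (tensor P (tensor Q T)).
Proof.
have [h hB hp] := assoc_map; have [k kB kp] := assoc_map'.
exists h; split.
- exact: subD_of_B.
- move=> s; apply: tens_ext3l => [x y|x y|p q t].
  + by rewrite [lact _ _]tens_lactB hB.
  + by rewrite hB [LHS]tens_lactB.
  + rewrite [lact _ _]tens_lact_pt [lact s (pt p q : tensor P Q)]tens_lact_pt.
    by rewrite !hp [RHS]tens_lact_pt.
- move=> x s; move: x; apply: tens_ext3l => [x y|x y|p q t].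
  + by rewrite [ract _ _]tens_ractB hB.
  + by rewrite hB [LHS]tens_ractB.
  + rewrite [ract _ _]tens_ract_pt !hp [RHS]tens_ract_pt.
    by rewrite [ract (pt q t : tensor Q T) s]tens_ract_pt.
- exists k.
  + apply: tens_ext3l => [x y|x y|p q t] //; first by rewrite hB kB.
    by rewrite hp kp.
  + apply: tens_ext3r => [x y|x y|p q t] //; first by rewrite kB hB.
    by rewrite kp hp.
Qed.

End Assoc.
End IsoTensor.

Section Picard.
Variables (S : nuRingType) (hS : has_local_units S).
Implicit Types P Q T : bimod S.

Lemma lu_list (rs : seq S) :
  exists e : S, forall r, r \in rs -> e ** r = r /\ r ** e = r.
Proof.
by have [E hE] := hS; have [//|e _ he] := lu_fin hE (rs := rs); exists e.
Qed.

Lemma ring_unital (s : S) : exists e, e ** s = s /\ s ** e = s.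
Proof. by have [e he] := lu_list [:: s]; exists e; apply: he; rewrite mem_head. Qed.

Definition regular_bimod : bimod S.
Proof.
apply: (@Bimod S S (@numul S) (@numul S)).
- by move=> s t x; rewrite numulDl.
- by move=> s x y; rewrite numulDr.
- by move=> s t x; rewrite numulA.
- by move=> x y s; rewrite numulDl.
- by move=> x s t; rewrite numulDr.
- by move=> x s t; rewrite numulA.
- by move=> s x t; rewrite numulA.
- by move=> x; have [e [ex _]] := ring_unital x; exists [:: (e, x)]; rewrite big_seq1.
- by move=> x; have [e [_ xe]] := ring_unital x; exists [:: (x, e)]; rewrite big_seq1.
Defined.

Lemma sum_fix (A : zmodType) (I : eqType) (l : seq I) (F : I -> A) (h : A -> A) :
  (forall x y, h (x + y) = h x + h y) -> (forall i, i \in l -> h (F i) = F i) ->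
  h (\sum_(i <- l) F i) = \sum_(i <- l) F i.
Proof.
move=> hD; have h0 : h 0 = 0 by apply: (addrI (h 0)); rewrite -hD !addr0.
elim: l => [|i l IHl] hl; first by rewrite big_nil.
rewrite !big_cons hD hl ?mem_head // IHl // => j jl.
by rewrite hl // inE jl orbT.
Qed.

Lemma lact_unit P (x : P) : exists e, lact e x = x.
Proof.
have [l ->] := lact_unital x.
have [e he] := lu_list (map fst l); exists e; apply: sum_fix; first exact: lactDr.
by move=> i il; rewrite -lactA (he _ _).1 //; apply: map_f.
Qed.

Lemma ract_unit P (x : P) : exists e, ract x e = x.
Proof.
have [l ->] := ract_unital x.
have [e he] := lu_list (map snd l); exists e.
apply: (sum_fix (h := fun y => ract y e)); first by move=> *; rewrite ractDl.
by move=> i il; rewrite -ractA (he _ _).2 //; apply: map_f.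
Qed.

Lemma inj_surj_bij (A B : Type) (f : A -> B) (g : B -> A) :
  injective f -> cancel g f -> bijective f.
Proof. by move=> fI gK; exists g => // x; apply: fI; rewrite gK. Qed.

Lemma iso_1tensor P : bimod_iso (tensor regular_bimod P) P.
Proof.
have hl (s t : regular_bimod) (x : P) : lact (s + t) x = lact s x + lact t x.
  exact: lactDl.
have hm (s : regular_bimod) (t : S) (x : P) : lact (ract s t) x = lact s (lact t x).
  exact: lactA.
pose f : tensor regular_bimod P -> P := tlift (fun (s : regular_bimod) p => lact s p).
have fp s p : f (pt (s : regular_bimod) p) = lact s p.
  by apply: tlift_pt => // *; exact: lactDr.
have fB x y : f (x - y) = f x - f y.
  by apply: tliftB => // *; exact: lactDr.
have key t : exists e0, forall e, e ** e0 = e0 -> pt (e : regular_bimod) (f t) = t.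
  move: t; apply: tens_ind => [|x y [e1 h1] [e2 h2]|s p].
  - exists 0 => e _; have -> : f 0 = 0 by rewrite -(subrr 0) fB subrr.
    by rewrite -(subrr 0) ptBr subrr.
  - have [k hk] := lu_list [:: e1; e2]; exists k => e ek.
    have [k1 _] := hk _ (mem_head _ _).
    have [k2 _] : k ** e2 = e2 /\ e2 ** k = e2 by apply: hk; rewrite !inE eqxx orbT.
    rewrite fB ptBr h1 ?h2 //; first by rewrite -k2 numulA ek.
    by rewrite -k1 numulA ek.
  - have [k [ks _]] := ring_unital s; exists k => e ek.
    rewrite fp -ptM; congr pt; rewrite /= -ks numulA ek //.
exists f; split.
- exact: subD_of_B.
- move=> s; apply: tens_ext => [x y|x y|r p].
  + by rewrite [lact _ _]tens_lactB fB.
  + rewrite fB -[- f y]sub0r -(subrr (f y)).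
    by apply/eqP; rewrite eq_sym subr_eq -lactDr; apply/eqP; congr lact;
       rewrite subrr sub0r addrNK.
  + by rewrite [lact _ _]tens_lact_pt !fp [lact s r]/= lactA.
- move=> x s; move: x; apply: tens_ext => [x y|x y|r p].
  + by rewrite [ract _ _]tens_ractB fB.
  + by rewrite fB; apply/eqP; rewrite eq_sym subr_eq -ractDl addrNK.
  + by rewrite [ract _ _]tens_ract_pt !fp lractA.
- pose g p : tensor regular_bimod P := pt (sval (cid (lact_unit p)) : regular_bimod) p.
  have gK : cancel g f by move=> p; rewrite /g fp; exact: svalP (cid (lact_unit p)).
  apply: (inj_surj_bij (g := g)) => // x y fxy.
  have [e1 h1] := key x; have [e2 h2] := key y.
  have [k hk] := lu_list [:: e1; e2].
  have [k1 _] := hk _ (mem_head _ _).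
  have [k2 _] : k ** e2 = e2 /\ e2 ** k = e2 by apply: hk; rewrite !inE eqxx orbT.
  by rewrite -(h1 k k1) -(h2 k k2) fxy.
Qed.

Lemma iso_tensor1 P : bimod_iso (tensor P regular_bimod) P.
Proof.
have hr (x : P) (s t : regular_bimod) : ract x (s + t) = ract x s + ract x t.
  exact: ractDr.
have hm (x : P) (s : S) (t : regular_bimod) : ract (ract x s) t = ract x (lact s t).
  by rewrite [lact _ _]/= ractA.
pose f : tensor P regular_bimod -> P := tlift (fun p (s : regular_bimod) => ract p s).
have fp p s : f (pt p (s : regular_bimod)) = ract p s.
  by apply: tlift_pt => // *; exact: ractDl.
have fB x y : f (x - y) = f x - f y.
  by apply: tliftB => // *; exact: ractDl.
have key t : exists e0, forall e, e0 ** e = e0 -> pt (f t) (e : regular_bimod) = t.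
  move: t; apply: tens_ind => [|x y [e1 h1] [e2 h2]|p s].
  - exists 0 => e _; have -> : f 0 = 0 by rewrite -(subrr 0) fB subrr.
    by rewrite -(subrr 0) ptBl subrr.
  - have [k hk] := lu_list [:: e1; e2]; exists k => e ek.
    have [_ k1] := hk _ (mem_head _ _).
    have [_ k2] : k ** e2 = e2 /\ e2 ** k = e2 by apply: hk; rewrite !inE eqxx orbT.
    rewrite fB ptBl h1 ?h2 //; first by rewrite -k2 -numulA ek.
    by rewrite -k1 -numulA ek.
  - have [k [_ ks]] := ring_unital s; exists k => e ek.
    rewrite fp ptM; congr pt; rewrite /= -ks -numulA ek //.
exists f; split.
- exact: subD_of_B.
- move=> s; apply: tens_ext => [x y|x y|p r].
  + by rewrite [lact _ _]tens_lactB fB.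
  + by rewrite fB; apply/eqP; rewrite eq_sym subr_eq -lactDr addrNK.
  + by rewrite [lact _ _]tens_lact_pt !fp lractA.
- move=> x s; move: x; apply: tens_ext => [x y|x y|p r].
  + by rewrite [ract _ _]tens_ractB fB.
  + by rewrite fB; apply/eqP; rewrite eq_sym subr_eq -ractDl addrNK.
  + by rewrite [ract _ _]tens_ract_pt !fp [ract r s]/= ractA.
- pose g p : tensor P regular_bimod := pt p (sval (cid (ract_unit p)) : regular_bimod).
  have gK : cancel g f by move=> p; rewrite /g fp; exact: svalP (cid (ract_unit p)).
  apply: (inj_surj_bij (g := g)) => // x y fxy.
  have [e1 h1] := key x; have [e2 h2] := key y.
  have [k hk] := lu_list [:: e1; e2].
  have [_ k1] := hk _ (mem_head _ _).
  have [_ k2] : k ** e2 = e2 /\ e2 ** k = e2 by apply: hk; rewrite !inE eqxx orbT.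
  by rewrite -(h1 k k1) -(h2 k k2) fxy.
Qed.

Definition inverse_of P Q : Prop :=
  bimod_iso (tensor Q P) regular_bimod /\ bimod_iso regular_bimod (tensor P Q).

Definition invertible P : Prop := exists Q, inverse_of P Q.

(* An isomorphism class is represented by the predicate "is isomorphic to P". *)
Record pic := PicClass {
  pic_in :> bimod S -> Prop;
  pic_class : exists2 P, invertible P & pic_in = bimod_iso P }.

Lemma pic_eq (A B : pic) : (forall T, A T <-> B T) -> A = B.
Proof.
case: A B => [A hA] [B hB] /= AB.
have E : A = B by apply/funext => T; apply/propext.
by subst B; congr PicClass; exact: Prop_irrelevance.
Qed.

Definition cls P (hP : invertible P) : pic :=
  @PicClass (bimod_iso P) (ex_intro2 _ _ P hP erefl).

Lemma picP (A : pic) : exists P (hP : invertible P), A = cls hP.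
Proof.
case: A => A hA; have [P hP E] := hA.
by subst A; exists P, hP; apply: pic_eq.
Qed.

Lemma cls_eq P Q (hP : invertible P) (hQ : invertible Q) :
  cls hP = cls hQ <-> bimod_iso P Q.
Proof.
split=> [/(congr1 (fun A => pic_in A Q)) /= ->|PQ]; first exact: iso_refl.
apply: pic_eq => T /=; split; last exact: iso_trans.
by move=> PT; apply: iso_trans PT; apply: iso_sym.
Qed.

Lemma inverse_sym P Q : inverse_of P Q -> inverse_of Q P.
Proof. by move=> [h1 h2]; split; apply: iso_sym. Qed.

Lemma invertible_regular : invertible regular_bimod.
Proof.
exists regular_bimod; split; first exact: iso_1tensor.
exact/iso_sym/iso_1tensor.
Qed.

Lemma iso_cancel P Q Q' P' :
  bimod_iso (tensor Q Q') regular_bimod -> bimod_iso (tensor P P') regular_bimod ->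
  bimod_iso (tensor (tensor P Q) (tensor Q' P')) regular_bimod.
Proof.
move=> hQ hP; apply: iso_trans hP.
apply: (iso_trans (iso_tensorA _ _ _)); apply: iso_tensor; first exact: iso_refl.
apply: (iso_trans (iso_sym (iso_tensorA _ _ _))).
apply: (iso_trans _ (iso_1tensor _)); apply: iso_tensor => //; exact: iso_refl.
Qed.

Lemma invertible_tensor P Q :
  invertible P -> invertible Q -> invertible (tensor P Q).
Proof.
move=> [P' [h1 h2]] [Q' [k1 k2]]; exists (tensor Q' P'); split.
  exact: iso_cancel.
by apply: iso_sym; apply: iso_cancel; apply: iso_sym.
Qed.

Definition pic_mul (A B : pic) : pic.
Proof.
apply: (@PicClass (fun T => exists P Q, [/\ A P, B Q & bimod_iso (tensor P Q) T])).
have [P [hP EA]] := picP A; have [Q [hQ EB]] := picP B; subst A B.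
exists (tensor P Q); first exact: invertible_tensor.
apply/funext => T; apply/propext; split=> [[P1 [Q1 [/= h1 h2 h3]]]|h].
  by apply: iso_trans h3; apply: iso_tensor.
by exists P, Q; split=> //; apply: iso_refl.
Defined.

Lemma pic_mulE P Q (hP : invertible P) (hQ : invertible Q) :
  pic_mul (cls hP) (cls hQ) = cls (invertible_tensor hP hQ).
Proof.
apply: pic_eq => T /=; split=> [[P1 [Q1 [/= h1 h2 h3]]]|h].
  by apply: iso_trans h3; apply: iso_tensor.
by exists P, Q; split=> //; apply: iso_refl.
Qed.

Definition pic_one : pic := cls invertible_regular.

Lemma inverse_unique P Q T : inverse_of P Q -> inverse_of P T -> bimod_iso Q T.
Proof.
move=> [_ h] [k _].
apply: (iso_trans (iso_sym (iso_1tensor Q))).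
apply: (iso_trans (iso_tensor (iso_sym k) (iso_refl Q))).
apply: (iso_trans (iso_tensorA _ _ _)).
apply: (iso_trans (iso_tensor (iso_refl T) (iso_sym h))).
exact: iso_tensor1.
Qed.

Lemma inverse_iso P P' Q Q' :
  bimod_iso P P' -> bimod_iso Q Q' -> inverse_of P Q -> inverse_of P' Q'.
Proof.
move=> hP hQ [h1 h2]; split.
  by apply: iso_trans h1; apply: iso_tensor; apply: iso_sym.
by apply: (iso_trans h2); apply: iso_tensor.
Qed.

Lemma inverse_class P Q (hP : invertible P) : inverse_of P Q ->
  (fun T => exists2 P1, cls hP P1 & inverse_of P1 T) = bimod_iso Q.
Proof.
move=> hQ; apply/funext => T; apply/propext; split=> [[P1 /= h1 h2]|h].
  apply: inverse_unique hQ _; apply: inverse_iso h2; last exact: iso_refl.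
  exact: iso_sym.
exists P; first exact: iso_refl.
by apply: inverse_iso hQ => //; apply: iso_refl.
Qed.

Definition pic_inv (A : pic) : pic.
Proof.
apply: (@PicClass (fun T => exists2 P, A P & inverse_of P T)).
have [P [hP EA]] := picP A; subst A; have [Q hQ] := hP.
exists Q; first by exists P; apply: inverse_sym.
exact: inverse_class.
Defined.

Lemma pic_invE P Q (hP : invertible P) (hQ : invertible Q) :
  inverse_of P Q -> pic_inv (cls hP) = cls hQ.
Proof. by move=> h; apply: pic_eq => T /=; rewrite -(inverse_class hP h). Qed.

Definition Pic : grp.
Proof.
apply: (@Grp pic pic_mul pic_one pic_inv).
- move=> A B C; have [P [hP ->]] := picP A; have [Q [hQ ->]] := picP B.
  have [T [hT ->]] := picP C; rewrite !pic_mulE.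
  by apply/cls_eq/iso_sym/iso_tensorA.
- move=> A; have [P [hP ->]] := picP A; rewrite pic_mulE.
  exact/cls_eq/iso_1tensor.
- move=> A; have [P [hP ->]] := picP A; have [Q hQ] := hP.
  have iQ : invertible Q by exists P; apply: inverse_sym.
  by rewrite (pic_invE hP iQ hQ) pic_mulE; apply/cls_eq; case: hQ.
Defined.

End Picard.

Section Twist.
Variables (S : nuRingType) (hS : has_local_units S) (R : set S).
Implicit Types f g : aut_ring R.

Definition twist f : bimod S.
Proof.
apply: (@Bimod S S (@numul S) (fun m t => m ** f t)).
- by move=> s t x; rewrite numulDl.
- by move=> s x y; rewrite numulDr.
- by move=> s t x; rewrite numulA.
- by move=> x y s; rewrite numulDl.
- by move=> x s t; rewrite ar_add numulDr.
- by move=> x s t; rewrite ar_mul numulA.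
- by move=> s x t; rewrite numulA.
- by move=> x; have [e [ex _]] := ring_unital hS x; exists [:: (e, x)]; rewrite big_seq1.
- move=> x; have [e [_ xe]] := ring_unital hS x.
  by exists [:: (x, ar_inv f e)]; rewrite big_seq1 /= ar_invK.
Defined.

Lemma iso_twist1 : bimod_iso (twist (ar_one R)) (regular_bimod hS).
Proof. by exists id; split=> //; exists id. Qed.

Lemma iso_twistM f g : bimod_iso (tensor (twist f) (twist g)) (twist (ar_comp f g)).
Proof.
pose h0 (m : twist f) (n : twist g) : twist (ar_comp f g) := (m : S) ** f n.
have hDl m m' n : h0 (m + m') n = h0 m n + h0 m' n by exact: numulDl.
have hDr m n n' : h0 m (n + n') = h0 m n + h0 m n'.
  by rewrite /h0 ar_add numulDr.
have hM m s n : h0 (ract m s) n = h0 m (lact s n).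
  by rewrite /h0 /= ar_mul numulA.
pose h : tensor (twist f) (twist g) -> twist (ar_comp f g) := tlift h0.
have hp m n : h (pt (m : twist f) (n : twist g)) = m ** f n by exact: tlift_pt.
have hB x y : h (x - y) = h x - h y by exact: tliftB.
have key t : exists e0, forall e, e0 ** e = e0 ->
    pt (h t : twist f) (ar_inv f e : twist g) = t.
  move: t; apply: tens_ind => [|x y [e1 h1] [e2 h2]|m n].
  - exists 0 => e _; have -> : h 0 = 0 by rewrite -(subrr 0) hB subrr.
    by rewrite -(subrr 0) ptBl subrr.
  - have [k hk] := lu_list hS [:: e1; e2]; exists k => e ek.
    have [_ k1] := hk _ (mem_head _ _).
    have [_ k2] : k ** e2 = e2 /\ e2 ** k = e2 by apply: hk; rewrite !inE eqxx orbT.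
    rewrite hB [h x - h y]/(_ - _) ptBl h1 ?h2 //; first by rewrite -k2 -numulA ek.
    by rewrite -k1 -numulA ek.
  - have [k [_ nk]] := ring_unital hS (f n); exists k => e ek.
    rewrite hp -[m ** f n]/(ract (m : twist f) n) ptM; congr pt => /=.
    by rewrite -[LHS](ar_funK f) ar_mul ar_invK -nk -numulA ek nk ar_funK.
exists h; split.
- exact: subD_of_B.
- move=> s; apply: tens_ext => [x y|x y|m n].
  + by rewrite [lact _ _]tens_lactB hB.
  + by rewrite hB; apply/eqP; rewrite eq_sym subr_eq -lactDr addrNK.
  + by rewrite [lact _ _]tens_lact_pt !hp /= numulA.
- move=> x s; move: x; apply: tens_ext => [x y|x y|m n].
  + by rewrite [ract _ _]tens_ractB hB.
  + by rewrite hB; apply/eqP; rewrite eq_sym subr_eq -ractDl addrNK.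
  + by rewrite [ract _ _]tens_ract_pt !hp /= ar_mul numulA.
- pose g' (x : twist (ar_comp f g)) : tensor (twist f) (twist g) :=
    pt (x : twist f) (ar_inv f (sval (cid (ring_unital hS x))) : twist g).
  have gK : cancel g' h.
    move=> x; rewrite /g' hp ar_invK.
    by case: (svalP (cid (ring_unital hS x))).
  apply: (inj_surj_bij (g := g')) => // x y hxy.
  have [e1 h1] := key x; have [e2 h2] := key y.
  have [k hk] := lu_list hS [:: e1; e2].
  have [_ k1] := hk _ (mem_head _ _).
  have [_ k2] : k ** e2 = e2 /\ e2 ** k = e2 by apply: hk; rewrite !inE eqxx orbT.
  by rewrite -(h1 k k1) -(h2 k k2) hxy.
Qed.

Lemma twist_invertible f : invertible hS (twist f).
Proof.
exists (twist (ar_invg f)); split.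
  apply: (iso_trans (iso_twistM _ _)).
  have -> : ar_comp (ar_invg f) f = ar_one R.
    by apply: ar_eq => s /=; rewrite ar_funK.
  exact: iso_twist1.
apply: iso_sym; apply: (iso_trans (iso_twistM _ _)).
have -> : ar_comp f (ar_invg f) = ar_one R.
  by apply: ar_eq => s /=; rewrite ar_invK.
exact: iso_twist1.
Qed.

Definition pic_twist : ghom (Aut_rings R) (Pic hS).
Proof.
apply: (@Ghom (Aut_rings R) (Pic hS) (fun f => cls (twist_invertible f))).
move=> f g; rewrite [RHS]pic_mulE; apply/cls_eq/iso_sym/iso_twistM.
Defined.

End Twist.

(* Main.v *)
Require Import Defs.
From mathcomp Require Import all_boot all_algebra.
From mathcomp Require Import boolp classical_sets.

Set Implicit Arguments.
Unset Strict Implicit.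

Local Open Scope ring_scope.

(** The whole proposition rests on one characterization: for [l] in
    Aut_{S-R}(S), the automorphism [hat X l] is the unique [f] such that
    [l (s t) = (l s) (f t)] for all [s] and [t] (lemma [hatP]).  In other words
    [hat X l = f] exactly when [l], besides being left linear, is right linear
    as a map from [S] to [S_f].

    The equation holds for [hat X l] because, for a common local unit [e] of
    [l s] and [t], both sides equal [(l s) l^-1(e) l(t)].  Uniqueness holds
    because [l] is surjective: the equation prescribes [u (f t)] for every [u],
    and a local unit [u] of [f t] recovers [f t].

    Taking [f = 1], the kernel of the hat map consists of the right [S]-linear
    [l].  For a general [f], the preimages of [f] are the isomorphisms from [S]
    to [S_f], each of which is automatically right [R]-linear since [f] fixes
    [R]; so [f] is in the image if and only if [[S_f]] is trivial in Pic(S).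
    The description of the kernel by the values [l e] comes from
    [hat l s = l^-1(e) s l(e)] and [l^-1(e) l(e) = e] for [s] in [eSe]: the map
    fixes [s] as soon as [l e] commutes with it, while right linearity of [l]
    yields [(l e) a = l (e a) = l (a e) = a (l e)] for [a] in [eSe]. *)

Section HatTheory.
Variables (S : nuRingType) (R E : set S) (X : lu_extension R E).
Implicit Types (l : aut_bimod R) (f : aut_ring R) (e s t : S).

Lemma ab_hat l s t : l (s ** t) = l s ** hat_fun X l t.
Proof.
have [e [[_ [_ le]] ut]] := Unit_common X (l s) t.
by rewrite (hat_funE' X l ut) numulA -ab_inv_left le ab_funK ab_left.
Qed.

Lemma numulI_lu s t : (forall u, u ** s = u ** t) -> s = t.
Proof.
move=> st; have [e [[_ [es _]] [_ [et _]]]] := Unit_common X s t.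
by rewrite -es st et.
Qed.

(** Since [l] is onto, twisted right linearity prescribes [u (f t)] for every
    [u], hence [f t]; so [hat X l] is the only twist making [l] right linear. *)
Lemma hatP l f : hat X l = f <-> forall s t, l (s ** t) = l s ** f t.
Proof.
split=> [<- s t|lf]; first exact: ab_hat.
apply: ar_eq => t; apply: numulI_lu => u.
by rewrite -(ab_invK l u) -lf ab_hat.
Qed.

Lemma hat_eq1_bilinear l :
  hat X l = ar_one R <-> exists m : aut_bimod [set: S], ab_restrict R m = l.
Proof.
split=> [/hatP lS|[m <-]]; last by apply/hatP => s t /=; rewrite ab_right.
exists (AutBimod (ab_funK l) (ab_invK l) (ab_add l) (ab_left l)
  (fun s t _ => lS s t)).
exact: ab_eq.
Qed.

Lemma corner_fix e x : e ** e = e -> corner e x -> e ** x = x /\ x ** e = x.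
Proof.
by move=> ee [s ->]; split; rewrite ?numulA ?ee // -numulA ee.
Qed.

Lemma hat_eq1_center l e :
  hat X l = ar_one R -> E e -> center (corner e) (l e).
Proof.
move=> /hatP lS Ee; have ee := lu_idem (ext_base X) Ee.
split=> [|a /(corner_fix ee)[ea ae]].
  by exists (l e); rewrite -ab_left ee -lS ee.
by rewrite -lS -ab_left ea ae.
Qed.

Lemma hat_eq1_units l :
  hat X l = ar_one R <-> forall e, E e -> units (center (corner e)) e (l e).
Proof.
split=> [l1 e Ee|lU].
  have ee := lu_idem (ext_base X) Ee; have Re := lu_sub (ext_base X) Ee.
  split; first exact: hat_eq1_center.
  (* The inverse of [l e] is [l^-1 e], central since the kernel is a group. *)
  exists (ab_inv l e); last by rewrite (ab_mulV l Re ee) (ab_mulV' l Re ee).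
  apply: (hat_eq1_center (l := ab_invg l)) => //.
  by rewrite (gfunV (hat X) l) l1; exact: ar_eq.
apply: ar_eq => s; have [e us] := Unit_ex X s.
have Re := Unit_R X us; have [Ee [es se]] := us.
have ee := lu_idem (ext_base X) Ee; have [[_ leC] _] := lU e Ee.
rewrite [LHS](hat_funE X l us) -numulA -leC; last by exists s; rewrite es se.
by rewrite numulA (ab_mulV' l Re ee) es.
Qed.

(** Any isomorphism from [S] to [S_f] lies in Aut_{S-R}(S), because [f] fixes
    [R], and [hatP] then reads its right linearity as [hat X l = f]. *)
Lemma hat_image (hS : has_local_units S) f :
  (exists l, hat X l = f) <-> bimod_iso (regular_bimod hS) (twist hS f).
Proof.
split=> [[l /hatP lf]|[g [gD gl gr [g' gK g'K]]]].
  exists l; split; [exact: ab_add | exact: ab_left | exact: lf |].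
  by exists (ab_inv l); [exact: ab_funK | exact: ab_invK].
have gR s r : R r -> g (s ** r) = (g s : S) ** r.
  by move=> Rr; rewrite -{2}(ar_fix f Rr) -[RHS]/(ract (g s) r) -gr.
by exists (@AutBimod S R g g' gK g'K gD gl gR); apply/hatP => s t; apply: gr.
Qed.

Lemma pic_twist_eq1 (hS : has_local_units S) f :
  pic_twist hS R f = gone <-> bimod_iso (regular_bimod hS) (twist hS f).
Proof.
apply: (iff_trans (cls_eq (twist_invertible hS f) (invertible_regular hS))).
by split; exact: iso_sym.
Qed.

End HatTheory.

Lemma exact_at_ker (G H : grp) (f : ghom G H) : exact_at (ker_incl f) f.
Proof. by move=> x; split=> [[y <-]|fx]; [exact: svalP y | exists (exist _ x fx)]. Qed.

Lemma exact_at_ker_incl (G H : grp) (f : ghom G H) :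
  exact_at (hom_from1 (Ker f)) (ker_incl f).
Proof. by move=> x; split=> [[_ <-]|x1] //; exists tt; exact: ker_eq. Qed.

Theorem proposition2p3 (S : nuRingType) (R E : set S) (X : lu_extension R E) :
  [/\ exact_at (hom_from1 (Ker (hat X))) (ker_incl (hat X)),
      exact_at (ker_incl (hat X)) (hat X),
      exact_at (hat X) (pic_twist (ext_has_lu X) R),
      (forall l : Aut_bimod R, hat X l = gone <->
         forall e : S, E e -> units (center (corner e)) e ((l : aut_bimod R) e))
    & (forall l : Aut_bimod R, hat X l = gone <->
         exists m : Aut_bimod [set: S], bimod_restrict R m = l)].
Proof.
split.
- exact: exact_at_ker_incl.
- exact: exact_at_ker.
- move=> f; apply: (iff_trans (hat_image X (ext_has_lu X) f)).
  exact: iff_sym (pic_twist_eq1 _ _).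
- exact: hat_eq1_units.
- exact: hat_eq1_bilinear.
Qed.
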